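(* Let $K$ be a field, let $R=K[x_1,\ldots,x_n]$, and let $I$ be a square-free monomial ideal of $R$ such that $\overline{I^2}=I^2$. Then $\operatorname{Ass}(I^2)\subseteq\operatorname{Ass}(I^k)$ for all $k\geq 2$. In particular, if $I$ is the vertex cover ideal of a finite simple graph on the vertex set $\{x_1,\ldots,x_n\}$, then $\operatorname{Ass}(I^2)\subseteq\operatorname{Ass}(I^k)$ for all $k\geq 2$.
   Context: For an ideal $L$ of $R$, $\operatorname{Ass}(L)$ denotes the set of associated primes of the $R$-module $R/L$. The integral closure $\overline{L}$ of $L$ is the set of all $x\in R$ satisfying an equation $x^m+a_1x^{m-1}+\cdots+a_{m-1}x+a_m=0$ with $m\ge 1$ and $a_i\in L^i$ for each $i$. A square-free monomial ideal is an ideal generated by square-free monomials. For a finite simple graph $G$ on the vertex set $\{x_1,\ldots,x_n\}$ (identified with the variables of $R$) with edge set $E$, the edge ideal is $I(G)=\langle x_ix_j\mid \{x_i,x_j\}\in E\rangle$, and the vertex cover ideal of $G$ is its Alexander dual $I(G)^{\vee}=\bigcap_{\{x_i,x_j\}\in E}\langle x_i,x_j\rangle$. *)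

(* Defs.v *)
From mathcomp Require Import all_boot all_order all_algebra.
From mathcomp Require Import mathcomp_extra boolp classical_sets.
From mathcomp.multinomials Require Import mpoly.

Set Implicit Arguments.
Unset Strict Implicit.
Unset Printing Implicit Defensive.

Import GRing.Theory.
Local Open Scope ring_scope.
Local Open Scope classical_set_scope.

(* Ideals are sets, not [idealr] predicates: the latter exclude the unit ideal,
   which is a square-free monomial ideal (and the cover ideal of an edgeless
   graph). *)
Section Ideals.
Variable R : comNzRingType.
Implicit Types (S L P : set R) (x f : R).

Definition is_ideal L : Prop :=
  [/\ L 0, forall x y, L x -> L y -> L (x + y) & forall a x, L x -> L (a * x)].

Definition is_prime_ideal P : Prop :=
  [/\ is_ideal P, ~ P 1 & forall x y, P (x * y) -> P x \/ P y].

Definition ideal_gen S : set R :=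
  [set x | exists2 s : seq (R * R),
     forall p, p \in s -> S p.2 & x = \sum_(p <- s) p.1 * p.2].

Definition ideal_mul L1 L2 : set R :=
  ideal_gen [set x | exists y z, [/\ L1 y, L2 z & x = y * z]].

Definition ideal_exp L (k : nat) : set R := iter k (ideal_mul L) setT.

Definition integral_closure L : set R :=
  [set x | exists m (a : nat -> R),
     [/\ (1 <= m)%N,
         forall i, (1 <= i <= m)%N -> ideal_exp L i (a i)
       & x ^+ m + \sum_(1 <= i < m.+1) a i * x ^+ (m - i) = 0]].

(* The annihilator of the class of [f] in the R-module R/L. *)
Definition ann_class L f : set R := [set r | L (r * f)].

(* Ass(L), the set of associated primes of the R-module R/L. *)
Definition Ass L : set (set R) :=
  [set P | is_prime_ideal P /\ exists f, P = ann_class L f].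

End Ideals.

Section MonomialIdeals.
Variables (K : fieldType) (n : nat).

Definition squarefree_mnm (m : 'X_{1..n}) : Prop := forall i, (m i <= 1)%N.

Definition squarefree_monomial_ideal (I : set {mpoly K[n]}) : Prop :=
  exists2 M : set 'X_{1..n}, (forall m, M m -> squarefree_mnm m) &
    I = ideal_gen [set 'X_[m] | m in M].

(* For an edgeless graph this is the empty intersection, i.e. the whole ring. *)
Definition cover_ideal (e : rel 'I_n) : set {mpoly K[n]} :=
  \bigcap_(ij in [set ij : 'I_n * 'I_n | e ij.1 ij.2])
    ideal_gen [set 'X_(ij.1); 'X_(ij.2)].

End MonomialIdeals.

Arguments cover_ideal K {n} e _.

(* Main.v *)
(** For any finitely generated ideal [I] of a domain with [I^2] integrally closed,
    let [P = I^2 : f]. If no [f w^(k-2)], with [w] a generator of [I], has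
    annihilator [P] modulo [I^k], then, [P] being prime, a single [t] outside [P]
    satisfies [t f w^(k-2) \in I^k] for all generators [w]. By the pigeonhole
    principle [t f I^M] is contained in [I^2 I^M] for large [M], so the determinant
    trick makes [t f] integral over [I^2]: hence [t \in P], a contradiction.

    For a cover ideal, every monomial weight bounds the integral closure just as it
    bounds the ideal. A vertex cover meets a closed walk of length [l], counted with
    multiplicity, at least [ceil(l/2)] times; so a monomial [u] in the integral
    closure of [I^2] has weight at least [2 ceil(l/2)] on it. Walks of length [2]
    give [u_i + u_j >= 2] on edges, and odd closed walks cannot stay in [{u = 1}],
    which is thus 2-colourable; the two colours, together with [{u >= 2}], are the
    two vertex covers whose product divides [u]. *)
Require Import Defs.
From HB Require Import structures.
From mathcomp Require Import all_boot all_order all_algebra.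
From mathcomp Require Import zify.
From mathcomp Require Import mathcomp_extra boolp classical_sets.
From mathcomp.multinomials Require Import mpoly.

Set Implicit Arguments.
Unset Strict Implicit.
Unset Printing Implicit Defensive.

Import GRing.Theory.
Local Open Scope ring_scope.
Local Open Scope classical_set_scope.

(** * Ideals, their products and their powers *)

Lemma bigcap_ideal (R : comNzRingType) (T : Type) (D : set T) (F : T -> set R) :
  (forall i, D i -> is_ideal (F i)) -> is_ideal (\bigcap_(i in D) F i).
Proof.
move=> idF; split=> [i Di|x y Fx Fy i Di|a x Fx i Di];
  have [F0 FD FM] := idF i Di.
- exact: F0.
- by apply: FD; [apply: Fx | apply: Fy].
- by apply: FM; apply: Fx.
Qed.

Section IdealTheory.
Variable R : comNzRingType.
Implicit Types (S L J : set R) (x y z : R) (s : seq R).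

Lemma ideal_sum L (T : eqType) (r : seq T) (F : T -> R) :
  is_ideal L -> (forall i, i \in r -> L (F i)) -> L (\sum_(i <- r) F i).
Proof.
move=> [L0 LD _] LF; rewrite big_seq.
by elim/big_ind: _.
Qed.

Lemma ideal_gen_ideal S : is_ideal (ideal_gen S).
Proof.
split.
- by exists [::]; rewrite ?big_nil.
- move=> x y [s Ss ->] [t St ->]; exists (s ++ t); last by rewrite big_cat.
  by move=> p; rewrite mem_cat => /orP[/Ss|/St].
- move=> a x [s Ss ->]; exists [seq (a * p.1, p.2) | p <- s].
    by move=> _ /mapP[p /Ss Sp ->].
  by rewrite big_map mulr_sumr; apply: eq_bigr => p _; rewrite mulrA.
Qed.

Lemma ideal_gen_mem S x : S x -> ideal_gen S x.
Proof.
move=> Sx; exists [:: (1, x)]; last by rewrite big_seq1 mul1r.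
by move=> p; rewrite inE => /eqP ->.
Qed.

Lemma ideal_gen_min S L : is_ideal L -> S `<=` L -> ideal_gen S `<=` L.
Proof.
move=> idL SL _ [s Ss ->]; apply: ideal_sum => // p /Ss /SL Lp.
by case: idL => _ _; apply.
Qed.

Lemma ideal_mul_mem L J x y : L x -> J y -> ideal_mul L J (x * y).
Proof. by move=> Lx Jy; apply: ideal_gen_mem; exists x, y. Qed.

Lemma ideal_exp_ideal L k : is_ideal (ideal_exp L k).
Proof. by case: k => [|k]; [split | apply: ideal_gen_ideal]. Qed.

Lemma ideal_exp_mul L a b x y :
  ideal_exp L a x -> ideal_exp L b y -> ideal_exp L (a + b) (x * y).
Proof.
move=> + Lb; elim: a x => [|a IH] x /=.
  by case: (ideal_exp_ideal L b) => _ _ LM _; apply: LM.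
case=> s Ss ->; rewrite mulr_suml; apply: ideal_sum.
  exact: (ideal_exp_ideal L (a + b).+1).
move=> p /Ss[u [v [Lu Lv ->]]]; rewrite -!mulrA.
case: (ideal_exp_ideal L (a + b).+1) => _ _; apply.
by apply: ideal_mul_mem => //; apply: IH.
Qed.

Lemma ideal_exp_anti L a b x :
  (a <= b)%N -> ideal_exp L b x -> ideal_exp L a x.
Proof.
move=> /subnK <-; elim: (b - a)%N x => [|c IH] x //=.
apply: ideal_gen_min; first exact: ideal_exp_ideal.
move=> _ [u [v [_ Lv ->]]]; case: (ideal_exp_ideal L a) => _ _; apply.
exact: IH.
Qed.

Lemma ideal_expD_sub L a b x :
  ideal_exp L (a + b) x -> ideal_mul (ideal_exp L a) (ideal_exp L b) x.
Proof.
elim: a x => [|a IH] x.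
  by move=> Lx; rewrite -[x]mul1r; apply: ideal_mul_mem.
rewrite addSn; apply: ideal_gen_min; first exact: ideal_gen_ideal.
move=> _ [y [v [Ly /IH[s Ss ->] ->]]]; rewrite mulr_sumr.
apply: ideal_sum; first exact: ideal_gen_ideal.
move=> p /Ss[u [w [Lu Lw ->]]]; rewrite mulrCA [y * _]mulrA.
case: (ideal_gen_ideal [set z | exists y0 z0,
  [/\ ideal_exp L a.+1 y0, ideal_exp L b z0 & z = y0 * z0]]) => _ _; apply.
by apply: ideal_mul_mem => //; apply: ideal_mul_mem.
Qed.

Lemma ideal_exp1 L x : L x -> ideal_exp L 1 x.
Proof. by move=> Lx; rewrite -[x]mulr1; apply: ideal_mul_mem. Qed.

Lemma ideal_exp_prod L l :
  (forall x, x \in l -> L x) -> ideal_exp L (size l) (\prod_(x <- l) x).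
Proof.
elim: l => [|x l IH] // Ll; rewrite big_cons /=.
apply: ideal_mul_mem; first by apply: Ll; rewrite mem_head.
by apply: IH => y ly; apply: Ll; rewrite inE ly orbT.
Qed.

Lemma ideal_exp_exp L x k : L x -> ideal_exp L k (x ^+ k).
Proof.
move=> Lx; elim: k => // k IH; rewrite exprS.
exact: ideal_mul_mem.
Qed.

(** This settles the zero ideal, for which the determinant trick has no nonzero generator to
    cancel. *)
Lemma ideal_exp_sub_set0 L k : L `<=` [set 0] -> is_ideal L ->
  (0 < k)%N -> ideal_exp L k = [set 0].
Proof.
move=> L0 [Lz _ _]; case: k => // k _; apply/seteqP; split.
  apply: ideal_gen_min.
    by split=> [//|x y -> ->|a x ->]; rewrite /= ?addr0 ?mulr0.
  by move=> _ [u [v [/L0 -> _ ->]]]; rewrite /= mul0r.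
by move=> _ ->; case: (ideal_exp_ideal L k.+1).
Qed.

(** Coefficients are indexed by positions in [s], so that they can serve as the rows of a matrix. *)
Lemma ideal_mul_gens J s x : is_ideal J ->
  ideal_mul J (ideal_gen [set` s]) x ->
  exists2 c : 'I_(size s) -> R, forall i, J (c i) &
    x = \sum_i c i * s`_i.
Proof.
move=> [J0 JD JM]; apply: (@ideal_gen_min _ [set x |
  exists2 c : 'I_(size s) -> R, forall i, J (c i) & x = \sum_i c i * s`_i]).
  split.
  - by exists (fun=> 0); rewrite ?big1 // => i _; rewrite mul0r.
  - move=> _ _ [c Jc ->] [d Jd ->]; exists (fun i => c i + d i).
      by move=> i; apply: JD.
    by rewrite -big_split; apply: eq_bigr => i _; rewrite mulrDl.
  - move=> a _ [c Jc ->]; exists (fun i => a * c i).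
      by move=> i; apply: JM.
    by rewrite mulr_sumr; apply: eq_bigr => i _; rewrite mulrA.
move=> _ [y [_ [Jy [t ts ->] ->]]].
elim: t ts => [|p t IH] ts.
  exists (fun=> 0) => //.
  by rewrite big_nil mulr0 big1 // => i _; rewrite mul0r.
have [|c Jc Ec] := IH; first by move=> q tq; apply: ts; rewrite inE tq orbT.
have sp : p.2 \in s by apply: ts; rewrite mem_head.
have lt_p : (index p.2 s < size s)%N by rewrite index_mem.
exists (fun i => c i + (if i == Ordinal lt_p then p.1 * y else 0)).
  by move=> i; apply: JD => //; case: ifP => _ //; apply: JM.
rewrite big_cons mulrDr Ec addrC.
under [RHS]eq_bigr do rewrite mulrDl.
rewrite big_split /=; congr (_ + _).
rewrite (bigD1 (Ordinal lt_p)) //= eqxx nth_index // big1 ?addr0.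
  by rewrite mulrA [y * _]mulrC.
by move=> i /negPf ->; rewrite mul0r.
Qed.

(** * Products of generators and the pigeonhole principle *)

Fixpoint monomials s (M : nat) : seq R :=
  if M is M'.+1 then [seq x * y | x <- s, y <- monomials s M'] else [:: 1].

Lemma monomialsP s M y : y \in monomials s M ->
  exists l, [/\ size l = M, {subset l <= s} & y = \prod_(x <- l) x].
Proof.
elim: M y => [|M IH] y /=.
  by rewrite inE => /eqP ->; exists [::]; rewrite big_nil.
case/allpairsP=> -[u v] /= [su /IH[l [sl ls ->]] ->].
exists (u :: l); split; rewrite /= ?sl ?big_cons //.
by move=> x; rewrite inE => /orP[/eqP->|/ls].
Qed.

Lemma ideal_exp_monomials s M :
  ideal_exp (ideal_gen [set` s]) M = ideal_gen [set` monomials s M].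
Proof.
elim: M => [|M IH].
  apply/seteqP; split=> // x _; rewrite -[x]mulr1.
  case: (ideal_gen_ideal [set` monomials s 0]) => _ _; apply.
  by apply: ideal_gen_mem; rewrite /= mem_head.
rewrite /ideal_exp iterS -/(ideal_exp _ M) IH; apply/seteqP; split.
  apply: ideal_gen_min; first exact: ideal_gen_ideal.
  move=> _ [_ [_ [[t ts ->] [r rs ->] ->]]].
  rewrite mulr_suml; apply: ideal_sum; first exact: ideal_gen_ideal.
  move=> p /ts sp; rewrite mulr_sumr; apply: ideal_sum.
    exact: ideal_gen_ideal.
  move=> q /rs sq; rewrite mulrACA.
  case: (ideal_gen_ideal [set` monomials s M.+1]) => _ _; apply.
  by apply: ideal_gen_mem; apply: allpairs_f.
apply: ideal_gen_min; first exact: ideal_gen_ideal.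
move=> _ /allpairsP[[u v] /= [su sv ->]].
by apply: ideal_mul_mem; apply: ideal_gen_mem.
Qed.

Lemma pigeonhole_count (T : eqType) (s l : seq T) k :
  {subset l <= s} -> (size s * k < size l)%N ->
  exists2 x, x \in s & (k <= count_mem x l)%N.
Proof.
move=> ls; rewrite ltnNge => /negP lt_sl; apply: contrapT => nex; apply: lt_sl.
have lt_k (x : T) : x \in s -> (count_mem x l <= k)%N.
  by move=> sx; rewrite leqNgt; apply/negP => /ltnW ?; apply: nex; exists x.
elim: s l {nex} ls lt_k => [|x s IH] l ls lt_k.
  by case: l ls {lt_k} => // y l /(_ y); rewrite mem_head => /(_ isT).
rewrite -(count_predC (pred1 x) l) mulSn leq_add ?lt_k ?mem_head //.
rewrite -size_filter; apply: IH.
  by move=> y; rewrite mem_filter /= => /andP[yx /ls]; rewrite inE (negPf yx).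
move=> y sy; apply: leq_trans (lt_k y _); last by rewrite inE sy orbT.
by rewrite count_filter; apply: sub_count => z /andP[].
Qed.

(** Among [size s * k + 1] factors some generator [x] occurs at least [k] times. Then [z * x ^+ k]
    lies in the power [k + 2], and each of the remaining factors raises the exponent by one. *)
Lemma ideal_exp_mul_power_gens s z k :
  (forall w, w \in s -> ideal_exp (ideal_gen [set` s]) k.+2 (z * w ^+ k)) ->
  forall y, y \in monomials s (size s * k).+1 ->
  ideal_exp (ideal_gen [set` s]) (2 + (size s * k).+1) (z * y).
Proof.
move=> zs _ /monomialsP[l [sl ls ->]].
have [|x sx le_k] := @pigeonhole_count _ s l k ls; first by rewrite sl.
rewrite (bigID (pred1 x)).
have -> : \prod_(y <- l | pred1 x y) y = x ^+ count_mem x l.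
  rewrite -big_filter -[in RHS]size_filter.
  elim: l {sl ls le_k} => [|y l IH] /=; first by rewrite big_nil.
  by case: eqP => [->|_] //=; rewrite big_cons IH exprS.
rewrite -(subnKC le_k) exprD mulrA mulrA -big_filter.
set c := count_mem x l in le_k *; set l' := filter _ l.
have sl' : (c + size l' = (size s * k).+1)%N.
  by rewrite -sl size_filter count_predC.
have -> : (2 + (size s * k).+1 = k.+2 + (c - k) + size l')%N by lia.
have Ix : ideal_gen [set` s] x by apply: ideal_gen_mem.
apply: ideal_exp_mul; first apply: ideal_exp_mul.
- exact: zs.
- exact: ideal_exp_exp.
- apply: ideal_exp_prod => y; rewrite mem_filter => /andP[_ /ls sy].
  exact: ideal_gen_mem.
Qed.

(** * Characteristic polynomials and the determinant trick *)

Lemma char_poly_coef_ideal J r (A : 'M[R]_r) i : is_ideal J ->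
  (forall i j, J (A i j)) -> ideal_exp J (r - i) (char_poly A)`_i.
Proof.
move=> idJ JA.
(* [Q] is multiplicative, and each entry of [char_poly_mx A] satisfies [Q 1]. Subtraction is
   truncated, so coefficients of degree at least [m] are unconstrained. *)
pose Q m (p : {poly R}) := forall i, ideal_exp J (m - i) p`_i.
have QM a b p q : Q a p -> Q b q -> Q (a + b)%N (p * q).
  move=> Qp Qq h; rewrite coefM; apply: ideal_sum.
    exact: ideal_exp_ideal.
  move=> j _; apply: (@ideal_exp_anti _ _ (a - j + (b - (h - j)))).
    by have := ltn_ord j; lia.
  exact: ideal_exp_mul.
suff: Q r (char_poly A) by apply.
move=> h; rewrite /char_poly /determinant coef_sum; apply: ideal_sum.
  exact: ideal_exp_ideal.
move=> sg _; rewrite -signr_odd mulr_sign.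
have QP (g : 'I_r -> 'I_r) : Q r (\prod_i char_poly_mx A i (g i)).
  (* Writing [r] as a sum of ones lets the degree bound grow along with the product. *)
  rewrite -[X in Q X]card_ord -sum1_card.
  elim/big_ind2: _ => [||i' _] //.
    by move=> p a q b; apply: QM.
  move=> l; rewrite !mxE coefB coefMn coefX coefC.
  case: l => [|l]; last by rewrite subSS sub0n.
  rewrite subn0 /= mul0rn sub0r; apply: ideal_exp1.
  by case: idJ => _ _ JM; rewrite -mulN1r; apply: JM.
case: (odd _); last exact: QP; rewrite coefN -mulN1r.
by case: (ideal_exp_ideal J (r - h)) => _ _; apply; apply: QP.
Qed.
End IdealTheory.

Section Domain.
Variable R : idomainType.
Implicit Types (L J P : set R) (x y z : R) (s : seq R).

(** Multiplication by [z] acts on the vector of generators as a matrix [A] over [J]. So [z - A]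
    kills this nonzero vector, its determinant vanishes in the domain, and [char_poly A] gives the
    integral equation. *)
Lemma determinant_trick J s z : is_ideal J ->
  (exists2 x, x \in s & x != 0) ->
  (forall x, x \in s -> ideal_mul J (ideal_gen [set` s]) (z * x)) ->
  integral_closure J z.
Proof.
move=> idJ [x0 sx0 x0N0] zs; pose r := size s.
have /choice[c Pc] : forall i : 'I_r, exists c : 'I_r -> R,
    (forall j, J (c j)) /\ z * s`_i = \sum_j c j * s`_j.
  move=> i; have [|c Jc Ec] := ideal_mul_gens idJ (zs s`_i _).
    exact: mem_nth.
  by exists c.
pose A : 'M[R]_r := \matrix_(i, j) c i j.
pose v : 'cV[R]_r := \col_i s`_i.
have Av0 : (z%:M - A) *m v = 0.
  rewrite mulmxBl mul_scalar_mx; apply/matrixP => i j; rewrite !mxE.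
  rewrite (proj2 (Pc i)); apply/eqP; rewrite subr_eq0; apply/eqP.
  by apply: eq_bigr => h _; rewrite !mxE.
have det0 : \det (z%:M - A) = 0.
  have := congr1 (mulmx (\adj (z%:M - A))) Av0.
  rewrite mulmxA mul_adj_mx mulmx0 mul_scalar_mx => /matrixP.
  have lt_x : (index x0 s < r)%N by rewrite index_mem.
  move=> /(_ (Ordinal lt_x) 0); rewrite !mxE /= nth_index // => /eqP.
  by rewrite mulf_eq0 (negPf x0N0) orbF => /eqP.
have root_z : (char_poly A).[z] = 0.
  rewrite -det0 /char_poly -horner_evalE -det_map_mx; congr (\det _).
  apply/matrixP => i j; rewrite !mxE /= horner_evalE !hornerE.
  by rewrite hornerMn hornerX.
have r_gt0 : (0 < r)%N by rewrite /r; case: (s) sx0.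
exists r, (fun i => (char_poly A)`_(r - i)); split=> //.
  move=> i /andP[_ le_ir]; rewrite -{1}(subKn le_ir).
  by apply: char_poly_coef_ideal => // ? ?; rewrite mxE; apply: (proj1 (Pc _)).
apply: etrans root_z; rewrite horner_coef size_char_poly big_add1 /= big_mkord.
rewrite [RHS](reindex_inj rev_ord_inj) [RHS]big_ord_recl /= subSS subn0.
have -> : (char_poly A)`_r = 1.
  by have /monicP := char_poly_monic A; rewrite /lead_coef size_char_poly.
by rewrite mul1r; congr (_ + _); apply: eq_bigr => i _; rewrite /bump subSS.
Qed.

(** * Associated primes of powers when the square is integrally closed *)

Theorem Ass_square_sub_fg s k :
  let I := ideal_gen [set` s] in
  integral_closure (ideal_exp I 2) `<=` ideal_exp I 2 ->
  (2 <= k)%N -> Ass (ideal_exp I 2) `<=` Ass (ideal_exp I k).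
Proof.
move=> I clI; case: k => [|[|k]] // _ P [primeP [f defP]].
have [I0|/existsNP[w0 /not_implyP[Iw0 /eqP w0N0]]] := pselect (I `<=` [set 0]).
  have idI : is_ideal I by apply: ideal_gen_ideal.
  rewrite (ideal_exp_sub_set0 I0 idI (isT : (0 < k.+2)%N)).
  rewrite -(ideal_exp_sub_set0 I0 idI (isT : (0 < 2)%N)).
  by split=> //; exists f.
apply: contrapT => nAss; have [_ P1 Pmul] := primeP.
(* The inclusion of [P] in the annihilator of [f * w ^+ k] modulo the power [k + 2] always holds.
   Hence it is strict when [P] is not associated to that power. *)
have avoid w : I w -> exists2 t, ~ P t & ideal_exp I k.+2 (t * f * w ^+ k).
  move=> Iw; apply: contrapT => nex; apply: nAss; split=> //.
  exists (f * w ^+ k); apply/seteqP; split=> r.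
    rewrite defP /ann_class /= mulrA => Irf.
    exact: (@ideal_exp_mul _ I 2 k _ _ Irf (ideal_exp_exp _ Iw)).
  rewrite /ann_class /= mulrA => Irf; apply: contrapT => nPr.
  by apply: nex; exists r.
(* Multiply the witnesses for all generators: as [P] is prime, the product stays outside [P]. *)
have [t nPt It] : exists2 t, ~ P t &
    forall w, w \in s -> ideal_exp I k.+2 (t * f * w ^+ k).
  have: forall w, w \in s -> I w by move=> w sw; apply: ideal_gen_mem.
  elim: (s) => [|w l IH] Il; first by exists 1.
  have [|t nPt It] := IH; first by move=> x lx; apply: Il; rewrite inE lx orbT.
  have [|t' nPt' It'] := avoid w; first by apply: Il; rewrite mem_head.
  have [_ _ IM] := ideal_exp_ideal I k.+2.
  exists (t * t'); first by case/Pmul.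
  move=> x; rewrite inE => /orP[/eqP ->|/It Itx]; last first.
    by rewrite [t * t']mulrC -!mulrA; apply: IM; rewrite mulrA.
  by rewrite -!mulrA; apply: IM; rewrite mulrA.
apply: nPt; rewrite defP /ann_class /=; apply: clI.
set M := (size s * k).+1.
apply: (@determinant_trick _ (monomials s M)); first exact: ideal_exp_ideal.
  (* If all products of [M] generators were zero, so would be [w0 ^+ M]. *)
  apply: contrapT => nex.
  have: ideal_exp I M (w0 ^+ M) by apply: ideal_exp_exp.
  rewrite ideal_exp_monomials => -[l ls]; apply/eqP.
  rewrite big_seq big1 ?expf_neq0 // => p /ls sp.
  have [->|p0] := eqVneq p.2 0; first by rewrite mulr0.
  by case: nex; exists p.2.
move=> x Mx; rewrite -ideal_exp_monomials; apply: ideal_expD_sub.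
exact: ideal_exp_mul_power_gens.
Qed.
End Domain.

(** * Monomial weights and integral closure *)

(** The exponent rises one step at a time. If [p = q * 'X^d] with [d < c], dividing the equation by
    ['X^(d * m)] leaves coefficients divisible by ['X]. Evaluation at 0 then gives [q.[0] ^+ m = 0],
    so ['X] divides [q]. *)
Lemma Xn_dvd_integral (D : idomainType) (c m : nat) (b : nat -> {poly D}) p :
  (0 < m)%N ->
  (forall i, (1 <= i <= m)%N -> exists r, b i = r * 'X^(c * i)) ->
  p ^+ m + \sum_(1 <= i < m.+1) b i * p ^+ (m - i) = 0 ->
  exists q, p = q * 'X^c.
Proof.
move=> m_gt0 bX Ep.
suff: forall d, (d <= c)%N -> exists q, p = q * 'X^d by apply.
elim=> [|d IH] lt_dc; first by exists p; rewrite mulr1.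
have [q Eq] := IH (ltnW lt_dc).
have /choice[r Er] : forall i, exists r,
    (1 <= i <= m)%N -> b i = r * 'X^(c * i).
  move=> i; case: (boolP (1 <= i <= m)%N) => [/bX[r Er]|_]; last by exists 0.
  by exists r.
have Eqm :
    q ^+ m + \sum_(1 <= i < m.+1) r i * 'X^((c - d) * i) * q ^+ (m - i) = 0.
  apply: (@mulIf _ ('X^(d * m))); first by rewrite expf_neq0 ?polyX_eq0.
  rewrite mul0r -[RHS]Ep mulrDl mulr_suml Eq exprMn -exprM; congr (_ + _).
  rewrite big_nat [RHS]big_nat; apply: eq_bigr => i; rewrite ltnS => im.
  rewrite Er // exprMn -exprM -!mulrA; congr (_ * _).
  rewrite mulrCA [RHS]mulrCA -!exprD; congr (_ * _ ^+ _).
  by case/andP: im => _ im; nia.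
have: root q 0.
  have /(congr1 (fun p : {poly D} => p.[0])) := Eqm.
  rewrite hornerD horner_exp horner_sum horner0 big_nat big1 ?addr0.
    by move/eqP; rewrite expf_eq0 m_gt0.
  move=> i /andP[i_gt0 _]; rewrite !hornerM hornerXn expr0n.
  by rewrite muln_eq0 subn_eq0 leqNgt lt_dc eqn0Ngt i_gt0 /= mulr0 mul0r.
case/factor_theorem=> q' Eq'; exists q'.
by rewrite Eq Eq' subr0 -mulrA -exprS.
Qed.

Section Weights.
Variables (K : fieldType) (n : nat).
Implicit Types (lam : 'I_n -> nat) (m : 'X_{1..n}) (f g : {mpoly K[n]}).

Definition weight lam m : nat := (\sum_i lam i * m i)%N.

(* The variable [X_i] is kept next to [T^(lam i)] so that no two terms of the
   same weight cancel. *)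
Definition grade lam : {mpoly K[n]} -> {poly {mpoly K[n]}} :=
  mmap (polyC \o @mpolyC n K) (fun i => ('X_i)%:P * 'X^(lam i)).

HB.instance Definition _ lam := GRing.RMorphism.on (grade lam).

Lemma gradeE lam f :
  grade lam f = \sum_(m <- msupp f) (f@_m *: 'X_[m])%:P * 'X^(weight lam m).
Proof.
apply: eq_bigr => m _; rewrite /= -mul_mpolyC polyCM -mulrA; congr (_ * _).
rewrite mpolyXE_id rmorph_prod /weight expr_sum -big_split /=.
by apply: eq_bigr => i _; rewrite exprMn rmorphXn -exprM.
Qed.

(** Phrased as divisibility, so that ideal operations and integral equations pass through the
    morphism [grade lam]; [weight_geP] gives the description by supports. *)
Definition weight_ge lam c : set {mpoly K[n]} :=
  [set f | exists q, grade lam f = q * 'X^c].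

Lemma weight_geP lam c f :
  weight_ge lam c f <-> forall m, m \in msupp f -> (c <= weight lam m)%N.
Proof.
split=> [[q Eq] m fm|fc].
  rewrite leqNgt; apply/negP => lt_mc.
  (* This coefficient is [f@_m] on the left, and zero on the right because the weight is below
     [c]. *)
  have := congr1 (fun p : {poly _} => (p`_(weight lam m))@_m) Eq.
  rewrite coefMXn lt_mc mcoeff0 gradeE coef_sum raddf_sum /=.
  rewrite (bigD1_seq m) ?msupp_uniq //= coefCM coefXn eqxx mulr1.
  rewrite mcoeffZ mcoeffX eqxx mulr1 big1 ?addr0 => [/eqP|m' m'm].
    by rewrite mcoeff_eq0 fm.
  rewrite coefCM coefXn; case: eqP => _; rewrite ?mulr0 ?mcoeff0 // mulr1.
  by rewrite mcoeffZ mcoeffX (negPf m'm) mulr0.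
exists (\sum_(m <- msupp f) (f@_m *: 'X_[m])%:P * 'X^(weight lam m - c)).
rewrite gradeE mulr_suml big_seq [RHS]big_seq; apply: eq_bigr => m /fc le_cm.
by rewrite -mulrA -exprD subnK.
Qed.

Lemma weight_ge_ideal lam c : is_ideal (weight_ge lam c).
Proof.
split.
- by exists 0; rewrite rmorph0 mul0r.
- by move=> f g [p Ef] [q Eg]; exists (p + q); rewrite rmorphD /= mulrDl Ef Eg.
- by move=> a f [p Ef]; exists (grade lam a * p); rewrite rmorphM /= Ef mulrA.
Qed.

Lemma weight_ge_exp lam c L k : L `<=` weight_ge lam c ->
  ideal_exp L k `<=` weight_ge lam (c * k).
Proof.
move=> Lc; elim: k => [|k IH] /=.
  by move=> f _; exists (grade lam f); rewrite muln0 mulr1.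
apply: ideal_gen_min; first exact: weight_ge_ideal.
move=> _ [f [g [/Lc [p Ef] /IH[q Eg] ->]]]; exists (p * q).
by rewrite rmorphM /= Ef Eg mulrACA -exprD mulnS.
Qed.

Lemma weight_ge_integral lam c L : L `<=` weight_ge lam c ->
  integral_closure L `<=` weight_ge lam c.
Proof.
move=> Lc f [m [a [m_gt0 La Ef]]].
apply: (@Xn_dvd_integral _ c m (grade lam \o a)) => //.
  by move=> i /La/(weight_ge_exp Lc).
rewrite -[RHS](rmorph0 (grade lam)) -[in RHS]Ef rmorphD rmorphXn rmorph_sum.
by congr (_ + _); apply: eq_bigr => i _; rewrite rmorphM rmorphXn.
Qed.
End Weights.

(** * Membership of monomials in ideals *)

Section MonomialMembership.
Variables (K : fieldType) (n : nat).
Implicit Types (L : set {mpoly K[n]}) (m : 'X_{1..n}).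

Lemma ideal_msupp L (f : {mpoly K[n]}) : is_ideal L ->
  (forall m, m \in msupp f -> L 'X_[m]) -> L f.
Proof.
move=> idL Lm; rewrite (mpolyE f); apply: ideal_sum => // m /Lm LX.
by rewrite -mul_mpolyC; case: idL => _ _; apply.
Qed.

Lemma ideal_mnm_le L m m' : is_ideal L ->
  (m <= m')%MM -> L 'X_[m] -> L 'X_[m'].
Proof.
by move=> [_ _ LM] /submK <-; rewrite mpolyXD; apply: LM.
Qed.

(** There are only finitely many square-free exponents, one for each function from the variables to
    [bool]. *)
Lemma squarefree_ideal_fg (I : set {mpoly K[n]}) :
  squarefree_monomial_ideal I ->
  exists s : seq {mpoly K[n]}, I = ideal_gen [set` s].
Proof.
move=> [M sqM ->].
pose mnm (F : {ffun 'I_n -> bool}) : 'X_{1..n} := [multinom F i : nat | i < n].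
exists [seq 'X_[m] | m <- codom mnm & `[< M m >]].
congr ideal_gen; apply/seteqP; split=> [_ [m Mm <-]|f /mapP[m]] /=.
  apply: map_f; rewrite mem_filter asboolT //=.
  suff -> : m = mnm [ffun i => m i == 1%N] by apply: codom_f.
  apply/mnmP => i; rewrite mnmE ffunE.
  by have := sqM _ Mm i; case: (m i) => [|[]].
by rewrite mem_filter => /andP[/asboolP Mm _] ->; exists m.
Qed.
End MonomialMembership.

(** * Two-colouring of graphs without odd closed walks *)

(* [x] gets its colour from the order in which the (distinct) components of its
   two lifts to the bipartite double cover are enumerated. *)
Lemma odd_cycle_free_coloring (T : finType) (r : rel T) : ssrbool.symmetric r ->
  (forall x p, path r x p -> last x p = x -> ~~ odd (size p)) ->
  exists c : T -> bool, forall x y, r x y -> c y = ~~ c x.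
Proof.
move=> symr even_r.
pose rr := [rel a b : T * bool | r a.1 b.1 && (b.2 == ~~ a.2)].
have symrr : ssrbool.symmetric rr.
  by move=> [x a] [y b] /=; rewrite symr; case: a b => [] [].
have csym := sym_connect_sym symrr.
(* A path joining the two lifts of [x] would project to a closed walk of odd length. *)
have disc x : fingraph.root rr (x, false) != fingraph.root rr (x, true).
  rewrite root_connect //; apply/negP => /connectP[p xp px].
  have path_rr y q : path rr y q ->
      path r y.1 [seq a.1 | a <- q] /\ (last y q).2 = y.2 (+) odd (size q).
    elim: q y => [|z q IH] y /=; first by rewrite addbF.
    by case/andP=> /andP[-> /eqP zy] /IH[-> ->]; rewrite zy addNb addbN.
  have [rp] := path_rr _ _ xp; rewrite -px /= => odd_p.
  have cl : last x [seq a.1 | a <- p] = x.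
    by rewrite -[X in last X](erefl (x, false).1) last_map -px.
  by have := even_r _ _ rp cl; rewrite size_map -odd_p.
exists (fun x => enum_rank (fingraph.root rr (x, false)) <
                 enum_rank (fingraph.root rr (x, true)))%N.
move=> x y rxy.
have E b : fingraph.root rr (y, b) = fingraph.root rr (x, ~~ b).
  by apply/eqP; rewrite root_connect // csym connect1 //= rxy negbK eqxx.
rewrite !E; have := disc x; rewrite -(inj_eq enum_rank_inj) -val_eqE /=.
by case: ltngtP.
Qed.

(** * Cover ideals and the integral closure of their squares *)

Section CoverIdeal.
Variables (K : fieldType) (n : nat) (e : rel 'I_n).
Implicit Types (m : 'X_{1..n}).

Definition vertex_cover m := forall i j, e i j -> (0 < m i + m j)%N.

Lemma cover_idealP (f : {mpoly K[n]}) :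
  cover_ideal K e f <-> forall m, m \in msupp f -> vertex_cover m.
Proof.
split=> [If m fm i j eij|fe [i j] /= eij].
  (* Both generators at the pair [(i, j)] have weight at least 1 for [lam], hence so does every
     monomial of the ideal. *)
  pose lam k : nat := ((k == i) + (k == j))%N.
  have lamE m' : weight lam m' = (m' i + m' j)%N.
    rewrite /weight /lam; under eq_bigr do rewrite mulnDl !mulnbl.
    by rewrite big_split /= -!big_mkcond !big_pred1_eq.
  rewrite -lamE; move: m fm; apply/weight_geP.
  apply: ideal_gen_min (If (i, j) eij); first exact: weight_ge_ideal.
  move=> _ [->|->] /=; apply/weight_geP => m'; rewrite msuppX inE => /eqP ->.
    by rewrite lamE mnm1E eqxx.
  by rewrite lamE !mnm1E eqxx addn1.
apply: ideal_msupp => [|m /fe /(_ i j eij)]; first exact: ideal_gen_ideal.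
have idX := ideal_gen_ideal [set 'X_i; 'X_j : {mpoly K[n]}].
rewrite addn_gt0 => /orP[] ?.
  apply: (@ideal_mnm_le _ _ _ U_(i)%MM) => //; first by rewrite lep1mP -lt0n.
  by apply: ideal_gen_mem; left.
apply: (@ideal_mnm_le _ _ _ U_(j)%MM) => //; first by rewrite lep1mP -lt0n.
by apply: ideal_gen_mem; right.
Qed.

Lemma cover_ideal_squarefree : squarefree_monomial_ideal (cover_ideal K e).
Proof.
exists [set m | squarefree_mnm m /\ vertex_cover m]; first by move=> m [].
apply/seteqP; split=> [f /cover_idealP fe|].
  apply: ideal_msupp => [|m /fe me]; first exact: ideal_gen_ideal.
  (* Cutting the exponents down to 1 leaves a square-free cover dividing [m]. *)
  pose m' : 'X_{1..n} := [multinom (0 < m i : nat) | i < n].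
  apply: (@ideal_mnm_le _ _ _ m'); first exact: ideal_gen_ideal.
    by apply/mnm_lepP => i; rewrite mnmE; case: (m i).
  apply: ideal_gen_mem; exists m' => //; split=> [i|i j eij].
    by rewrite mnmE leq_b1.
  by rewrite !mnmE; have := me i j eij; case: (m i); case: (m j).
apply: ideal_gen_min.
  by apply: bigcap_ideal => ij _; apply: ideal_gen_ideal.
move=> _ [m [_ me] <-]; apply/cover_idealP => m'.
by rewrite msuppX inE => /eqP ->.
Qed.

(** Each edge of the walk contributes at least 1. Summing over the edges counts every vertex of the
    closed walk twice, so twice the sum is at least the length. *)
Lemma cover_closed_walk m x p : vertex_cover m -> path e x p -> last x p = x ->
  (uphalf (size p) <= \sum_(i <- p) m i)%N.
Proof.
move=> me xp px.
have walk y q : path e y q ->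
    (size q <= \sum_(i <- belast y q) m i + \sum_(i <- q) m i)%N.
  elim: q y => [|z q IH] y //= /andP[/me yz /IH]; rewrite !big_cons; lia.
have : (\sum_(i <- x :: p) m i = \sum_(i <- belast x p) m i + m x)%N.
  by rewrite lastI px -cats1 big_cat big_seq1.
by rewrite big_cons; have := walk x p xp; lia.
Qed.

(** The weight of a variable is its multiplicity in the walk. Rounding up comes before doubling, so
    for odd walks the bound exceeds the length by one. *)
Lemma integral_closure_closed_walk f m x p :
  integral_closure (ideal_exp (cover_ideal K e) 2) f -> m \in msupp f ->
  path e x p -> last x p = x -> ((uphalf (size p)).*2 <= \sum_(i <- p) m i)%N.
Proof.
move=> clf fm xp px; pose lam i := count_mem i p.
have lamE m' : weight lam m' = (\sum_(i <- p) m' i)%N.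
  rewrite /weight /lam; elim: (p) => [|y q IH].
    by rewrite big_nil big1.
  rewrite big_cons -IH; under eq_bigr do rewrite /= mulnDl mulnbl eq_sym.
  by rewrite big_split /= -big_mkcond big_pred1_eq.
rewrite -lamE -muln2; move: m fm; apply/weight_geP.
apply: weight_ge_integral clf; apply: weight_ge_exp => g /cover_idealP ge.
by apply/weight_geP => m /ge me; rewrite lamE; apply: cover_closed_walk xp px.
Qed.

Lemma cover_ideal_square_integral : ssrbool.symmetric e ->
  integral_closure (ideal_exp (cover_ideal K e) 2)
    `<=` ideal_exp (cover_ideal K e) 2.
Proof.
move=> syme f clf; apply: ideal_msupp => [|m fm]; first exact: ideal_exp_ideal.
have walk x p := integral_closure_closed_walk (x := x) (p := p) clf fm.
have edge i j : e i j -> (2 <= m i + m j)%N.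
  move=> eij; have := walk i [:: j; i]; rewrite /= eij syme eij.
  by rewrite !big_cons big_nil addn0 addnC; apply.
(* On a closed walk of [r] all exponents are 1, so the weight equals the length, which the bound
   excludes for odd walks. *)
pose r := [rel i j | [&& e i j, m i == 1%N & m j == 1%N]].
have [|x p xp px|c Ec] := @odd_cycle_free_coloring _ r.
- by move=> i j /=; rewrite syme [X in _ && X]andbC.
- have ep : path e x p by apply: sub_path xp => i j /andP[].
  have := walk x p ep px.
  have -> : (\sum_(i <- p) m i = size p)%N.
    elim: p x xp {px ep} => [|y p IH] x; first by rewrite big_nil.
    by case/andP=> /and3P[_ _ /eqP my] /IH; rewrite big_cons my => ->.
  apply: contraTN => odd_p; rewrite -ltnNge uphalf_half odd_p.
  by have := odd_double_half (size p); rewrite odd_p; lia.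
(* Exponents of at least 2 give 1 to each half; an exponent 1 goes to the half of its colour. *)
pose half b : 'X_{1..n} :=
  [multinom ((1 < m i) || (m i == 1) && (c i == b) : nat) | i < n]%N.
(* On an edge the exponents sum to at least 2: either one of them is at least 2, or both are 1 with
   opposite colours. *)
have halfP b : cover_ideal K e 'X_[half b].
  apply/cover_idealP => m'; rewrite msuppX inE => /eqP -> i j eij.
  rewrite !mnmE; have := edge i j eij; have := Ec i j; rewrite /= eij.
  case: (m i) (m j) => [|[|?]] [|[|?]] //= Eij _; rewrite ?addn1 // Eij //.
  by case: (c i) b => [] [].
apply: (@ideal_mnm_le _ _ _ (half true + half false)%MM).
- exact: ideal_exp_ideal.
- apply/mnm_lepP => i; rewrite mnmDE !mnmE.
  by case: (m i) => [|[|?]] //=; case: (c i).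
- rewrite mpolyXD; apply: ideal_mul_mem => //; exact: ideal_exp1.
Qed.
End CoverIdeal.

Theorem corollary2p8 (K : fieldType) (n : nat) :
  (forall I : set {mpoly K[n]},
      squarefree_monomial_ideal I ->
      integral_closure (ideal_exp I 2) = ideal_exp I 2 ->
      forall k : nat, (2 <= k)%N -> Ass (ideal_exp I 2) `<=` Ass (ideal_exp I k))
  /\
  (forall e : rel 'I_n, ssrbool.symmetric e -> irreflexive e ->
      forall k : nat, (2 <= k)%N ->
      Ass (ideal_exp (cover_ideal K e) 2) `<=` Ass (ideal_exp (cover_ideal K e) k)).
Proof.
split=> [I sqI clI k k2|e syme _ k k2].
  have [s Es] := squarefree_ideal_fg sqI; rewrite Es in clI *.
  by apply: Ass_square_sub_fg; rewrite ?clI.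
have [s Es] := squarefree_ideal_fg (cover_ideal_squarefree K e).
have := @cover_ideal_square_integral K n e syme; rewrite Es => clI.
exact: Ass_square_sub_fg.
Qed.
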